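(* Let $G$ be any group and let $k\geq 1$ be an integer. Then the set $FC_k(G)=\{x\in G : |x|_k<\infty\}$ is a subgroup of $G$, and the group $\gamma_{k+1}(FC_k(G))$ is locally normal.
   Context: For elements of a group, $[x,y]=x^{-1}y^{-1}xy$, and $[x_1,\dots,x_k]=[\dots[[x_1,x_2],x_3]\dots,x_k]$ denotes the left-normed commutator. For a group $G$, an element $a\in G$ and an integer $k\geq 1$, $|a|_k$ denotes the cardinality of the set $\{[a,x_1,\dots,x_k] : x_1,\dots,x_k\in G\}$. $\gamma_i(H)$ denotes the $i$th term of the lower central series of a group $H$ (with $\gamma_1(H)=H$). A group $H$ is locally normal if every finite subset of $H$ is contained in a finite normal subgroup of $H$. *)

(* Defs.v *)
From mathcomp Require Import all_boot.
From mathcomp Require Import monoid.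
From mathcomp Require Import boolp classical_sets cardinality.

Set Implicit Arguments.
Unset Strict Implicit.
Unset Printing Implicit Defensive.

Local Open Scope classical_set_scope.
Local Open Scope group_scope.

(* Subgroups of a possibly infinite group G are subsets of G, and the lower
   central series of a subgroup is computed inside G. *)

Definition subgroup (G : groupType) (H : set G) : Prop := group_closed [in H].

Definition generated (G : groupType) (A : set G) : set G :=
  smallest (@subgroup G) A.

(* commg associates to the left: this is [a, x_1, ..., x_k] for the tuple
   x = (x_1, ..., x_k). *)
Definition lcommg (G : groupType) (a : G) (k : nat) (x : k.-tuple G) : G :=
  foldl commg a x.

Definition FC (G : groupType) (k : nat) : set G :=
  [set a | finite_set (range (fun x : k.-tuple G => lcommg a x))].

Arguments FC : clear implicits.

(* Numbered from 1, as for 'L_n(H) in the finite case: both the 0th and the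
   1st terms are H itself. *)
Definition lower_central (G : groupType) (n : nat) (H : set G) : set G :=
  iter n.-1
    (fun K => generated [set [~ x, y] | x in K & y in H]) H.

Definition normal_subgroup (G : groupType) (N H : set G) : Prop :=
  [/\ subgroup N, N `<=` H & forall x h, N x -> H h -> N (x ^ h)].

Definition locally_normal (G : groupType) (H : set G) : Prop :=
  forall A : set G, finite_set A -> A `<=` H ->
  exists N : set G, [/\ finite_set N, normal_subgroup N H & A `<=` N].

(* Main.v *)
Require Import Defs.
From mathcomp Require Import all_boot.
From mathcomp Require Import monoid.
From mathcomp Require Import boolp classical_sets cardinality.

(** Write [fc G] for the set of elements with finitely many conjugates (this
is [FC G 1]) and [fc_torsion G] for its elements of finite order.

That [FC G k] is a subgroup comes from the identity
[[~ u * v^-1, y] = [~ u, y] ^ v^-1 * ([~ v, y] ^ v^-1)^-1]: iterating it, each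
value [[~ a * b^-1, x_1, .., x_k]] is [u * v^-1] with [u] and [v] conjugates of
values of the same shape at [a] and at [b] ([commg_values_div]).  For
[k >= 1] such values are FC-elements, because the value [[~ c, x_k]] is
[c^-1 * c ^ x_k] and [c] has as many conjugates as there are values
[[~ c, x]]; so finitely many values have finitely many conjugates altogether.

Local normality is reduced to torsion.  By Dietzmann's lemma a finite set of
FC-elements of finite order lies in a finite normal subgroup of [G]; hence
[fc_torsion G] is a normal subgroup, and each of its subgroups is locally
normal.  It remains to see that the lower central term [k + 1] of [FC G k] lies
in [fc_torsion G].  Since [[~ a, x]] is in [FC G k] as soon as [a] is in
[FC G k.+1], the term number [k] lies in [fc G], so everything rests on
[fc_FC_commg_torsion]: [[~ c, x]] is torsion for [c] in [fc G] and [x] in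
[FC G k].

By Schur's theorem ([fc_commg_torsion]) the group [fc G] is commutative modulo
[fc_torsion G], so commutation with [x] acts on the quotient as an endomorphism.
The finitely many values [[~ x, c ^+ m, x, .., x]], [m] in [nat], are there the
powers of [[~ x, c, x, .., x]], which is therefore torsion.  Finally [c]
commutes with a power of [x], which makes the action of [x] on the conjugates of
[c] both of finite order and unipotent; on a torsion-free quotient such an
action is trivial ([fc_engel2]).

Dietzmann's lemma and Schur's theorem both come from one fact on words,
[finite_generated]: if a finite set [S] is stable under conjugation by its
elements and each [s] in [S] has a power [s ^+ n] that is a product of fewer
than [n] elements of [S], then [S] generates a finite subgroup.  For Dietzmann
that product is empty; for Schur [S] is the set of commutators of a
central-by-finite group and the product is given by [commg_power_shorten]. *)

Set Implicit Arguments.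
Unset Strict Implicit.
Unset Printing Implicit Defensive.

Local Open Scope classical_set_scope.
Local Open Scope group_scope.

(** * Finite sets and subgroups *)
Lemma finite_range_collision (V : Type) (f : nat -> V) :
  finite_set (range f) -> exists i n, (0 < n)%N /\ f i = f (i + n)%N.
Proof.
move=> finf; apply: contrapT => no_coll; apply: infinite_nat.
have wlog_inj i j : (i < j)%N -> f i <> f j.
  move=> lt_ij eq_f; apply: no_coll; exists i, (j - i)%N.
  by rewrite subn_gt0 subnKC // ltnW.
have inj_f : injective f.
  move=> i j eq_f; case: (ltngtP i j) => // lt_ij.
  - by case: (wlog_inj _ _ lt_ij).
  - by case: (wlog_inj _ _ lt_ij).
have <- : f @^-1` (range f) = [set: nat].
  by apply/seteqP; split=> // i _; exists i.
by apply: finite_preimage => // i j _ _; apply: inj_f.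
Qed.

(** Used with [f] recording a coset modulo the centre and [h] the commutator. *)
Lemma finite_image2_factor (T V W : Type) (K : set T) (f : T -> V)
    (h : T -> T -> W) :
  finite_set (f @` K) ->
  (forall u u' v v', K u -> K u' -> K v -> K v' ->
     f u = f u' -> f v = f v' -> h u v = h u' v') ->
  finite_set [set h u v | u in K & v in K].
Proof.
move=> finf hf; have [[t0 Kt0]|noK] := pselect (K !=set0); last first.
  apply: sub_finite_set (@finite_set0 W) => w [u Ku _].
  by case: noK; exists u.
have /choice [r rP] : forall p, exists t : T, (f @` K) p -> K t /\ f t = p.
  move=> p; have [[t Kt <-]|fKp] := pselect ((f @` K) p); first by exists t.
  by exists t0.
apply: sub_finite_set (finite_image2 (fun p q => h (r p) (r q)) finf finf).
move=> _ [u Ku [v Kv <-]]; exists (f u); first by exists u.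
exists (f v); first by exists v.
have [Kru eru] := rP (f u) (imageP f Ku).
have [Krv erv] := rP (f v) (imageP f Kv).
exact: hf.
Qed.

Lemma subgroupP (G : groupType) (H : set G) :
  subgroup H <-> H 1 /\ (forall x y, H x -> H y -> H (x * y^-1)).
Proof.
split=> [[H1 HB]|[H1 HB]].
  split=> [|x y Hx Hy]; first by have := H1; rewrite !inE.
  by have := HB x y; rewrite !inE; apply.
split=> [|x y]; first by rewrite !inE.
by rewrite !inE; apply: HB.
Qed.

Lemma subgroup1 (G : groupType) (H : set G) : subgroup H -> H 1.
Proof. by case/subgroupP. Qed.

Lemma subgroupV (G : groupType) (H : set G) x : subgroup H -> H x -> H x^-1.
Proof. by case/subgroupP => H1 HB Hx; rewrite -[x^-1]mul1g; apply: HB. Qed.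

Lemma subgroupM (G : groupType) (H : set G) x y :
  subgroup H -> H x -> H y -> H (x * y).
Proof.
move=> sH Hx /(subgroupV sH) Hy; rewrite -[y]invgK.
by case/subgroupP: sH => _; apply.
Qed.

Lemma subgroupX (G : groupType) (H : set G) x n :
  subgroup H -> H x -> H (x ^+ n).
Proof.
move=> sH Hx; elim: n => [|n IHn]; first exact: subgroup1.
by rewrite expgS; apply: subgroupM.
Qed.

Lemma generated_subgroup (G : groupType) (A : set G) : subgroup (generated A).
Proof.
apply/subgroupP; split=> [B [sB _]|x y Ax Ay B [sB AB]]; first exact: subgroup1.
have Bx : B x by apply: Ax.
have By : B y by apply: Ay.
by apply: (subgroupM sB) => //; apply: subgroupV.
Qed.

Lemma generated_sub (G : groupType) (A H : set G) :
  subgroup H -> A `<=` H -> generated A `<=` H.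
Proof. exact: smallest_sub. Qed.

Lemma sub_generated (G : groupType) (A : set G) : A `<=` generated A.
Proof. exact: sub_gen_smallest. Qed.

Definition conj_closed (G : groupType) (A : set G) : Prop :=
  forall x g, A x -> A (x ^ g).

Lemma generated_conj (G : groupType) (A : set G) :
  conj_closed A -> conj_closed (generated A).
Proof.
move=> cA x g; have sA := generated_subgroup A.
suff : generated A `<=` [set y | generated A (y ^ g)] by apply.
apply: generated_sub => [|y Ay]; last by apply: sub_generated; apply: cA.
apply/subgroupP; split=> [|y z /= Ay Az].
  by rewrite /= conj1g; exact (subgroup1 sA).
by rewrite conjMg conjVg; apply: (subgroupM sA) => //; exact (subgroupV sA Az).
Qed.

Lemma finite_submonoid_subgroup (G : groupType) (Q : set G) :
  finite_set Q -> Q 1 -> (forall x y, Q x -> Q y -> Q (x * y)) -> subgroup Q.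
Proof.
move=> finQ Q1 QM; apply/subgroupP; split=> // x y Qx Qy; apply: (QM) => //.
have QX n : Q (y ^+ n).
  by elim: n => [|n IHn] //; rewrite expgS; apply: QM.
have [|i [[|n] [// _ eq_y]]] := @finite_range_collision _ (fun n => y ^+ n).
  by apply: sub_finite_set finQ => _ [n _ <-].
have <- : y ^+ n = y^-1; last exact: QX.
apply: (@mulgI _ y); rewrite mulgV -expgS; apply: (@mulgI _ (y ^+ i)).
by rewrite mulg1 -expgnDr.
Qed.


(** * Finiteness from shortening words *)
Definition self_conj (G : groupType) (S : seq G) : Prop :=
  forall x y, x \in S -> y \in S -> x ^ y \in S.

(** All occurrences of [s] can be moved to the front: a letter [t] in the way
becomes its conjugate by a power of [s], which is again in [S]. *)
Lemma word_gather (G : groupType) (S : seq G) s l :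
  self_conj S -> s \in S -> {subset l <= S} ->
  exists l', [/\ {subset l' <= S}, (size l' + count_mem s l)%N = size l &
    \prod_(x <- l) x = s ^+ count_mem s l * \prod_(x <- l') x].
Proof.
move=> S_conj Ss; elim: l => [|t l IHl] lS.
  by exists [::]; split=> //; rewrite !big_nil mul1g.
have [|l' [l'S sz_l' prod_l]] := IHl.
  by move=> x lx; rewrite lS // inE lx orbT.
have St : t \in S by rewrite lS // mem_head.
rewrite big_cons prod_l /=; have [-> | neq_ts] := eqVneq t s.
  exists l'; split=> //; first by rewrite add1n addnS sz_l'.
  by rewrite add1n expgS mulgA.
exists (t ^ (s ^+ count_mem s l) :: l'); split=> /=.
- move=> x; rewrite inE => /orP [/eqP -> | /l'S //].
  elim: (count_mem s l) => [|n IHn]; first by rewrite conjg1.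
  by rewrite expgSr conjgM; apply: S_conj.
- by rewrite add0n addSn sz_l'.
- by rewrite add0n big_cons mulgA [t * _]conjgC -mulgA.
Qed.

Lemma leq_size_sum_count (T : eqType) (S l : seq T) :
  {subset l <= S} -> (size l <= \sum_(s <- S) count_mem s l)%N.
Proof.
elim: l => [|t l IHl] lS //=.
rewrite big_split /= -add1n leq_add //; last first.
  by apply: IHl => x lx; rewrite lS // inE lx orbT.
have -> : \sum_(s <- S) (t == s)%N = count (pred1 t) S.
  by rewrite -sumn_count sumnE big_map; apply: eq_bigr => s _; rewrite eq_sym.
by rewrite -has_count has_pred1 lS // mem_head.
Qed.

Definition power_shortens (G : groupType) (S : seq G) (s : G) : Prop :=
  exists (n : nat) (w : seq G),
    [/\ {subset w <= S}, (size w < n)%N & \prod_(x <- w) x = s ^+ n].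

(** In a word long enough some letter [s] occurs at least [N s] times; gathered
at the front, these occurrences can be replaced by a shorter word. *)
Lemma word_shorten (G : groupType) (S : seq G) :
  self_conj S -> (forall s, s \in S -> power_shortens S s) ->
  exists M, forall l, {subset l <= S} -> exists l',
    [/\ {subset l' <= S}, (size l' <= M)%N &
       \prod_(x <- l) x = \prod_(x <- l') x].
Proof.
move=> S_conj S_short.
have /choice [N NP] : forall s, exists n, s \in S -> exists w : seq G,
    [/\ {subset w <= S}, (size w < n)%N & \prod_(x <- w) x = s ^+ n].
  (* a dummy exponent outside S *)
  move=> s; have [/S_short [n nP]|] := boolP (s \in S); first by exists n.
  by exists 0%N.
exists (\sum_(s <- S) N s)%N => l; have [n] := ubnP (size l).
elim: n l => // n IHn l; rewrite ltnS => le_ln lS.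
have [le_lM|lt_Ml] := leqP (size l) (\sum_(s <- S) N s)%N; first by exists l.
have [s Ss le_Ns] : exists2 s, s \in S & (N s <= count_mem s l)%N.
  apply: contrapT => no_s; move: lt_Ml; apply/negP; rewrite -leqNgt.
  apply: leq_trans (leq_size_sum_count lS) _.
  rewrite [leqLHS]big_seq [leqRHS]big_seq; apply: leq_sum => s Ss.
  by have [/ltnW//|le_Ns] := ltnP (count_mem s l) (N s); case: no_s; exists s.
have [w [wS lt_wN prod_w]] := NP s Ss.
have [l' [l'S sz_l' ->]] := word_gather S_conj Ss lS.
pose r := nseq (count_mem s l - N s) s.
have -> : s ^+ count_mem s l * \prod_(x <- l') x = \prod_(x <- w ++ r ++ l') x.
  rewrite !big_cat /= mulgA prod_w big_nseq iter_mulg_1 -expgnDr subnKC //.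
apply: IHn.
  rewrite !size_cat size_nseq; apply: leq_trans le_ln; rewrite -sz_l' addnA addnC.
  by rewrite ltn_add2l -[ltnRHS](subnKC le_Ns) ltn_add2r.
move=> x; rewrite !mem_cat => /or3P [/wS//|/nseqP [-> //]|/l'S//].
Qed.

(** The products of words in [S] have bounded length, so they form a finite
set, stable under product; such a set is a subgroup, as inverses in it are
powers. *)
Lemma finite_generated (G : groupType) (S : seq G) :
  self_conj S -> (forall s, s \in S -> power_shortens S s) ->
  finite_set (generated [set` S]).
Proof.
move=> S_conj S_short; have [M MP] := word_shorten S_conj S_short.
pose Q m : set G := [set \prod_(x <- l) x | l in
  [set l | {subset l <= S} /\ (size l <= m)%N]].
have finQ m : finite_set (Q m).
  elim: m => [|m IHm].
    apply: sub_finite_set (finite_set1 1) => _ [[|x l] [_ sz_l] <-] //.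
    by rewrite big_nil.
  have finS : finite_set [set` S] by apply: finite_seq.
  have finSQ := finite_image2 (fun s p : G => s * p) finS IHm.
  apply: sub_finite_set (_ : finite_set ([set 1] `|` _)); last first.
    by rewrite finite_setU; split; [exact: finite_set1|exact: finSQ].
  move=> _ [[|s l] [lS sz_l] <-]; [left|right]; first by rewrite big_nil.
  rewrite big_cons; exists s; first by apply: lS; rewrite mem_head.
  exists (\prod_(x <- l) x) => //; exists l => //; split=> // x lx.
  by apply: lS; rewrite inE lx orbT.
apply: sub_finite_set (finQ M).
have sQ : subgroup (Q M).
  apply: finite_submonoid_subgroup => //.
    by exists [::] => //; rewrite big_nil.
  move=> _ _ [l1 [l1S _] <-] [l2 [l2S _] <-].
  have [|l [lS sz_l prod_l]] := MP (l1 ++ l2).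
    by move=> x; rewrite mem_cat => /orP [/l1S|/l2S].
  by exists l => //; rewrite -prod_l big_cat.
apply: generated_sub => // s Ss.
have [|l [lS sz_l prod_l]] := MP [:: s].
  by move=> x; rewrite inE => /eqP ->.
by exists l => //; rewrite -prod_l big_seq1.
Qed.

(** * FC-elements of finite order *)

Definition fc (G : groupType) : set G :=
  [set c | finite_set (range (fun g => c ^ g))].

Definition torsion (G : groupType) (x : G) : Prop :=
  exists n, (0 < n)%N /\ x ^+ n = 1.

Lemma fc_subgroup (G : groupType) : subgroup (@fc G).
Proof.
apply/subgroupP; split=> [|x y fcx fcy].
  by apply: sub_finite_set (finite_set1 1) => _ [g _ <-]; rewrite conj1g.
apply: sub_finite_set (finite_image2 (fun u v : G => u * v^-1) fcx fcy).
move=> _ [g _ <-]; rewrite conjMg conjVg.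
by exists (x ^ g); [exists g|exists (y ^ g) => //; exists g].
Qed.

Lemma fc_conj (G : groupType) : conj_closed (@fc G).
Proof.
move=> c g fcc; apply: sub_finite_set fcc => _ [h _ <-].
by rewrite -conjgM; exists (g * h).
Qed.

Lemma fc_commg (G : groupType) (c x : G) : fc c -> fc [~ c, x].
Proof.
move=> fcc; apply: subgroupM (fc_subgroup G) _ (fc_conj x fcc).
exact: subgroupV (fc_subgroup G) fcc.
Qed.

Lemma fc_commute_power (G : groupType) (c x : G) :
  fc c -> exists n, (0 < n)%N /\ commute c (x ^+ n).
Proof.
move=> fcc.
have [|i [n [n_gt0 eq_c]]] := @finite_range_collision _ (fun n => c ^ (x ^+ n)).
  by apply: sub_finite_set fcc => _ [n _ <-]; exists (x ^+ n).
exists n; split=> //; rewrite /commute conjgC; congr (_ * _).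
apply: (@conjg_inj _ (x ^+ i)); rewrite eq_c -conjgM -expgnDr.
by rewrite addnC.
Qed.

Lemma conj_set_finite (G : groupType) (A : set G) :
  finite_set A -> A `<=` @fc G ->
  finite_set [set x ^ g | x in A & g in [set: G]].
Proof.
move=> finA fcA.
apply: sub_finite_set (bigcup_finite finA fcA).
by move=> _ [x Ax [g _ <-]]; exists x => //; exists g.
Qed.

(** The conjugates of [A] form a finite set [S], and each [s] in [S] has a power
equal to the empty product. *)
Lemma dietzmann (G : groupType) (A : set G) :
  finite_set A -> A `<=` @fc G -> (forall x, A x -> torsion x) ->
  exists N : set G, [/\ finite_set N, subgroup N, conj_closed N & A `<=` N].
Proof.
move=> finA fcA torA; pose B := [set x ^ g | x in A & g in [set: G]].
have finB : finite_set B by apply: conj_set_finite.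
have cB : conj_closed B.
  move=> _ g [x Ax [h _ <-]]; exists x => //.
  by exists (h * g) => //; rewrite conjgM.
exists (generated B); split.
- have /finite_seqP [S BS] := finB; rewrite BS.
  have memS x : (x \in S) = (x \in B) by rewrite BS mem_setE.
  apply: finite_generated => [x y|s]; rewrite !memS !inE.
    by move=> Bx _; apply: cB.
  move=> [x /torA [n [n_gt0 xn1]] [g _ <-]]; exists n, [::]; split=> //.
  by rewrite big_nil -conjXg xn1 conj1g.
- exact: generated_subgroup.
- exact: generated_conj.
- move=> x Ax; apply: sub_generated; exists x => //.
  by exists 1 => //; rewrite conjg1.
Qed.

Definition fc_torsion (G : groupType) : set G := [set x | fc x /\ torsion x].

Lemma finite_subgroup_torsion (G : groupType) (N : set G) x :
  finite_set N -> subgroup N -> N x -> torsion x.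
Proof.
move=> finN sN Nx.
have [|i [n [n_gt0 eq_x]]] := @finite_range_collision _ (fun n => x ^+ n).
  by apply: sub_finite_set finN => _ [n _ <-]; apply: subgroupX.
exists n; split=> //; apply: (@mulgI _ (x ^+ i)).
by rewrite mulg1 -expgnDr.
Qed.

Lemma fc_torsion_subgroup (G : groupType) : subgroup (@fc_torsion G).
Proof.
apply/subgroupP; split=> [|x y [fcx torx] [fcy tory]].
  by split; [exact: subgroup1 (fc_subgroup G)|exists 1%N].
split.
  exact: subgroupM (fc_subgroup G) fcx (subgroupV (fc_subgroup G) fcy).
have [||| N [finN sN _ xyN]] := @dietzmann G [set x; y].
- exact: finite_set2.
- by move=> z [] ->.
- by move=> z [] ->.
apply: (finite_subgroup_torsion finN sN); apply: (subgroupM sN).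
  by apply: xyN; left.
by apply: (subgroupV sN); apply: xyN; right.
Qed.

Lemma fc_torsion_conj (G : groupType) : conj_closed (@fc_torsion G).
Proof.
move=> x g [fcx [n [n_gt0 xn1]]]; split; first exact: fc_conj.
by exists n; split=> //; rewrite -conjXg xn1 conj1g.
Qed.

(** As [w = [~ c, x]] satisfies [w = c^-1 * c ^ x], a power of [w] commuting with
[c] can be slid past the [c^-1] of the next factor; the two copies of [c] then
meet and form [[~ c ^+ 2, x]].  The product on the right has [n.+1] factors,
one fewer than the power on the left. *)
Lemma commg_power_shorten (G : groupType) (c x : G) n :
  commute c ([~ c, x] ^+ n.+1) ->
  [~ c, x] ^+ n.+2 = [~ c, x ^ c] ^+ n * [~ c ^+ 2, x].
Proof.
move=> cw; set w := [~ c, x] in cw *.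
have -> : [~ c, x ^ c] = w ^ c by rewrite conjRg {2}/conjg mulKg.
rewrite expgSr {2}/w -conjXg.
have -> : w ^+ n.+1 * [~ c, x] = c^-1 * w ^+ n.+1 * c ^ x.
  by rewrite /commg mulgA (commuteV (commute_sym cw)).
by rewrite expgSr /w /commg /conjg expg2 !gnorm.
Qed.

(** Schur's theorem.  The subgroup [K] generated by [a] and [b] has a centre of
finite index, so it has finitely many commutators, and these satisfy the
hypotheses of [finite_generated]. *)
Lemma fc_commg_torsion (G : groupType) (a b : G) :
  fc a -> fc b -> torsion [~ a, b].
Proof.
move=> fca fcb; pose K := generated [set a; b].
have sK : subgroup K by apply: generated_subgroup.
have Ka : K a by apply: sub_generated; left.
have Kb : K b by apply: sub_generated; right.
have fcK : K `<=` @fc G by apply: generated_sub (fc_subgroup G) _ => x [] ->.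
have KC u v : K u -> K v -> K (u ^ v).
  by move=> Ku Kv; do 2?apply: (subgroupM sK) => //; apply: (subgroupV sK).
have KR u v : K u -> K v -> K [~ u, v].
  by move=> Ku Kv; apply: (subgroupM sK); [apply: (subgroupV sK)|apply: KC].
pose f u := (a ^ u, b ^ u).
have finf : finite_set (f @` K).
  apply: sub_finite_set (finite_setX fca fcb) => _ [u _ <-].
  by split=> /=; exists u.
(* f u determines the coset of u modulo the centre of K *)
have f_center u u' v : f u = f u' -> K v -> commute v (u' / u).
  move=> [eqa eqb] Kv.
  suff : K `<=` [set y | commute y (u' / u)] by apply.
  apply: generated_sub => [|_ [] ->].
  - apply/subgroupP; split=> [|y z yC zC]; first exact/commute_sym/commute1.
    exact/commute_sym/commuteM/commuteV/commute_sym/zC/commute_sym/yC.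
  - by rewrite /= /commute conjgC conjgM -eqa conjgK.
  - by rewrite /= /commute conjgC conjgM -eqb conjgK.
have commg_f u u' v : K u -> K v -> f u = f u' -> [~ u, v] = [~ u', v].
  move=> Ku Kv fu; rewrite -[u'](mulgVK u); set z := u' / u.
  have zv : z ^ v = z by rewrite /conjg -(f_center u u' v) // mulKg.
  by rewrite !commgEl conjMg zv invgM -mulgA mulKg.
pose C := [set [~ u, v] | u in K & v in K].
have finC : finite_set C.
  apply: finite_image2_factor finf _ => u u' v v' Ku Ku' Kv Kv' fu fv.
  rewrite (commg_f u u') // -invgR (commg_f v v') //.
  by rewrite invgR.
have /finite_seqP [S CS] := finC.
have memS x : (x \in S) = (x \in C) by rewrite CS mem_setE.
have CK : C `<=` K by move=> _ [u Ku [v Kv <-]]; apply: KR.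
have Cconj x y : C x -> K y -> C (x ^ y).
  move=> [u Ku [v Kv <-]] Ky; rewrite conjRg.
  by exists (u ^ y); [exact: KC|exists (v ^ y) => //; exact: KC].
have finG : finite_set (generated [set` S]).
  apply: finite_generated => [x y|s]; rewrite !memS !inE.
    by move=> Cx Cy; apply: Cconj => //; apply: CK.
  case=> u Ku [v Kv <-].
  have [[|n] [// _ uw]] := fc_commute_power [~ u, v] (fcK _ Ku).
  exists n.+2, (rcons (nseq n [~ u, v ^ u]) [~ u ^+ 2, v]); split.
  - move=> x; rewrite mem_rcons inE memS inE => /orP [/eqP ->|/nseqP [-> _]].
      by exists (u ^+ 2); [exact: (subgroupX 2 sK)|exists v].
    by exists u => //; exists (v ^ u) => //; apply: KC.
  - by rewrite size_rcons size_nseq.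
  - rewrite -cats1 big_cat /= big_seq1 big_nseq iter_mulg_1.
    by rewrite commg_power_shorten.
apply: finite_subgroup_torsion finG (generated_subgroup _) _.
by apply: sub_generated; rewrite -CS; exists a => //; exists b.
Qed.

(** * Congruence modulo a normal subgroup *)

(** [normal_subgroup N [set: G]] without its trivial conditions. *)
Definition normal_in_whole (G : groupType) (N : set G) : Prop :=
  subgroup N /\ conj_closed N.

Definition eqmod (G : groupType) (N : set G) (x y : G) : Prop := N (x^-1 * y).

Lemma eqmod_refl (G : groupType) (N : set G) x : normal_in_whole N -> eqmod N x x.
Proof. by case=> sN _; rewrite /eqmod mulVg; exact (subgroup1 sN). Qed.

Lemma eqmod_sym (G : groupType) (N : set G) x y :
  normal_in_whole N -> eqmod N x y -> eqmod N y x.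
Proof. by case=> sN _ /(subgroupV sN); rewrite invgM invgK. Qed.

Lemma eqmod_trans (G : groupType) (N : set G) x y z :
  normal_in_whole N -> eqmod N x y -> eqmod N y z -> eqmod N x z.
Proof.
by case=> sN _ /(subgroupM sN) Nxy /Nxy; rewrite /eqmod -mulgA mulVKg.
Qed.

Lemma eqmodM (G : groupType) (N : set G) x x' y y' :
  normal_in_whole N -> eqmod N x x' -> eqmod N y y' -> eqmod N (x * y) (x' * y').
Proof.
case=> sN cN /(cN _ y) Nx Ny; rewrite /eqmod.
have -> : (x * y)^-1 * (x' * y') = (x^-1 * x') ^ y * (y^-1 * y').
  by rewrite /conjg !gnorm.
exact (subgroupM sN Nx Ny).
Qed.

Lemma eqmodV (G : groupType) (N : set G) x y :
  normal_in_whole N -> eqmod N x y -> eqmod N x^-1 y^-1.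
Proof.
move=> nN /(eqmod_sym nN) /(nN.2 _ y^-1); rewrite /eqmod.
by rewrite /conjg !gnorm.
Qed.

Lemma eqmodJ (G : groupType) (N : set G) x y g :
  normal_in_whole N -> eqmod N x y -> eqmod N (x ^ g) (y ^ g).
Proof. by move=> nN /(nN.2 _ g); rewrite /eqmod conjMg conjVg. Qed.

Lemma eqmodX (G : groupType) (N : set G) x y n :
  normal_in_whole N -> eqmod N x y -> eqmod N (x ^+ n) (y ^+ n).
Proof.
move=> nN Nxy; elim: n => [|n IHn]; first exact: eqmod_refl.
by rewrite !expgS; apply: eqmodM.
Qed.

Lemma eqmodR (G : groupType) (N : set G) x y g :
  normal_in_whole N -> eqmod N x y -> eqmod N [~ x, g] [~ y, g].
Proof. by move=> nN Nxy; apply: (eqmodM nN); [apply: eqmodV|apply: eqmodJ]. Qed.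

Lemma eqmod1 (G : groupType) (N : set G) x y :
  normal_in_whole N -> eqmod N x y -> N x -> N y.
Proof. by case=> sN _ Nxy /(subgroupM sN) /(_ Nxy); rewrite mulVKg. Qed.

(** * Commutation modulo torsion *)
Lemma fc_torsion_normal (G : groupType) : normal_in_whole (@fc_torsion G).
Proof. by split; [exact: fc_torsion_subgroup|exact: fc_torsion_conj]. Qed.

Lemma fc_torsion_root (G : groupType) (c : G) n :
  fc c -> (0 < n)%N -> fc_torsion (c ^+ n) -> fc_torsion c.
Proof.
move=> fcc n_gt0 [_ [m [m_gt0 cnm]]]; split=> //; exists (n * m)%N.
by rewrite muln_gt0 n_gt0 expgnA.
Qed.

(** In [[~ u * v, x] = [~ u, x] ^ v * [~ v, x]] the conjugation by [v] is
trivial modulo torsion, by Schur's theorem. *)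
Lemma fc_commg_eqmodM (G : groupType) (u v x : G) : fc u -> fc v ->
  eqmod (@fc_torsion G) [~ u * v, x] ([~ u, x] * [~ v, x]).
Proof.
move=> fcu fcv; have nT := fc_torsion_normal G.
have -> : [~ u * v, x] = [~ u, x] ^ v * [~ v, x].
  by rewrite /commg /conjg !gnorm.
apply: (eqmodM nT); last exact: eqmod_refl.
apply: (eqmod_sym nT); split; first exact/fc_commg/fc_commg.
exact/fc_commg_torsion/fcv/fc_commg.
Qed.

Lemma fc_commg_eqmodX (G : groupType) (u x : G) n : fc u ->
  eqmod (@fc_torsion G) [~ u ^+ n, x] ([~ u, x] ^+ n).
Proof.
move=> fcu; have nT := fc_torsion_normal G.
elim: n => [|n IHn]; first by rewrite comm1g; exact: eqmod_refl.
rewrite !expgS; apply: (eqmod_trans nT (fc_commg_eqmodM _ _ _)) => //.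
  exact (subgroupX n (fc_subgroup G) fcu).
by apply: (eqmodM nT) IHn; exact: eqmod_refl.
Qed.

Lemma fc_iter_commg_eqmodX (G : groupType) (u p x : G) n j :
  fc u -> eqmod (@fc_torsion G) p (u ^+ n) ->
  eqmod (@fc_torsion G) (foldl commg p (nseq j x)) (foldl commg u (nseq j x) ^+ n).
Proof.
have nT := fc_torsion_normal G.
elim: j u p => [|j IHj] u p fcu pu //=; apply: IHj; first exact: fc_commg.
exact: (eqmod_trans nT (eqmodR x nT pu) (fc_commg_eqmodX x n fcu)).
Qed.

(** Some power [x ^+ n] commutes with [v].  Modulo torsion [x] commutes with
[w = [~ v, x]], so that [1 = [~ v, x ^+ n]] is congruent to [w ^+ n], and [w] is
torsion. *)
Lemma fc_engel2 (G : groupType) (v x : G) :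
  fc v -> fc_torsion [~ v, x, x] -> fc_torsion [~ v, x].
Proof.
move=> fcv Tvxx; have nT := fc_torsion_normal G; set w := [~ v, x] in Tvxx *.
have [n [n_gt0 vxn]] := fc_commute_power x fcv.
apply: (fc_torsion_root _ n_gt0); first exact: fc_commg.
have vxX m : eqmod (@fc_torsion G) [~ v, x ^+ m] (w ^+ m).
  elim: m => [|m IHm]; first by rewrite commg1; exact: eqmod_refl.
  have -> : [~ v, x ^+ m.+1] = w * [~ v, x ^+ m] ^ x.
    by rewrite expgSr /w /commg /conjg !gnorm.
  rewrite expgS; apply: (eqmodM nT); first exact: eqmod_refl.
  apply: (eqmod_trans nT (eqmodJ x nT IHm)); rewrite conjXg.
  by apply: (eqmodX _ nT); apply: (eqmod_sym nT).
apply: (eqmod1 nT (vxX n)); have /eqP -> : [~ v, x ^+ n] == 1 by apply/commgP.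
exact (subgroup1 nT.1).
Qed.

Lemma fc_engel (G : groupType) (v x : G) j :
  fc v -> fc_torsion (foldl commg v (nseq j x)) -> fc_torsion [~ v, x].
Proof.
elim: j v => [|j IHj] v fcv /= Tv.
  have [sT cT] := fc_torsion_normal G.
  exact (subgroupM sT (subgroupV sT Tv) (cT _ x Tv)).
by apply: fc_engel2 => //; apply: (IHj _ (fc_commg x fcv)).
Qed.

(** * Left-normed commutator values *)

(** Sequences in place of tuples, to allow induction on either end. *)
Definition commg_values (G : groupType) (k : nat) (a : G) : set G :=
  [set foldl commg a s | s in [set s : seq G | size s = k]].

Lemma FCE (G : groupType) k (a : G) : FC G k a <-> finite_set (commg_values k a).
Proof.
rewrite /FC /=.
suff -> : range (fun x : k.-tuple G => lcommg a x) = commg_values k a by [].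
apply/seteqP; split=> [_ [x _ <-]|_ [s /= /eqP sz_s <-]].
  by exists x => //=; rewrite size_tuple.
by exists (Tuple sz_s).
Qed.

Lemma FC1_fc (G : groupType) : FC G 1 = @fc G.
Proof.
apply/seteqP; split=> c.
  move/FCE=> finc; apply: sub_finite_set (finite_image (fun z => c * z) finc).
  move=> _ [g _ <-]; exists [~ c, g]; last by rewrite /commg mulVKg.
  by exists [:: g].
move=> fcc; apply/FCE; apply: sub_finite_set (finite_image (fun z => c^-1 * z) fcc).
by move=> _ [[|g []] //= _ <-]; exists (c ^ g) => //; exists g.
Qed.

Lemma FC_commg (G : groupType) k (a x : G) : FC G k.+1 a -> FC G k [~ a, x].
Proof.
move=> /FCE fina; apply/FCE; apply: sub_finite_set fina => _ [s /= sz_s <-].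
by exists (x :: s) => //=; rewrite sz_s.
Qed.

(** A value is [[~ c, x]] with [c] in [FC G 1]. *)
Lemma commg_values_fc (G : groupType) k (a : G) :
  FC G k.+1 a -> commg_values k.+1 a `<=` @fc G.
Proof.
move=> FCa _ [s /= sz_s <-]; elim/last_ind: s k a sz_s FCa => // s x _ k a.
rewrite size_rcons foldl_rcons => -[sz_s] FCa; apply: fc_commg.
rewrite -FC1_fc; elim: s k a sz_s FCa => [|y s IHs] [|k] a //= [sz_s] FCa.
by apply: (IHs k) => //; apply: FC_commg.
Qed.

Definition commg_value_classes (G : groupType) (k : nat) (a : G) : set G :=
  [set z ^ g | z in commg_values k a & g in [set: G]].

Lemma commg_value_classes_finite (G : groupType) k (a : G) :
  FC G k.+1 a -> finite_set (commg_value_classes k.+1 a).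
Proof.
by move=> FCa; apply: conj_set_finite; [apply/FCE|apply: commg_values_fc].
Qed.

Lemma commg_value_classes_rcons (G : groupType) k (a z y : G) :
  commg_value_classes k a z -> commg_value_classes k.+1 a [~ z, y].
Proof.
move=> [_ [s /= sz_s <-] [g _ <-]]; exists [~ foldl commg a s, y ^ g^-1].
  by exists (rcons s (y ^ g^-1)); rewrite ?foldl_rcons //= size_rcons sz_s.
by exists g => //; rewrite conjRg conjgKV.
Qed.

Lemma commg_value_classes_conj (G : groupType) k (a : G) :
  conj_closed (commg_value_classes k a).
Proof.
by move=> _ h [z az [g _ <-]]; exists z => //; exists (g * h) => //; rewrite conjgM.
Qed.

(** By induction on the length, from
[[~ u * v^-1, y] = [~ u, y] ^ v^-1 * ([~ v, y] ^ v^-1)^-1].  Passing to the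
conjugates of the values absorbs the exponents [v^-1], which also depend on the
entries of the commutator. *)
Lemma commg_values_div (G : groupType) k (a b : G) :
  commg_values k (a * b^-1) `<=`
  [set u * v^-1 | u in commg_value_classes k a & v in commg_value_classes k b].
Proof.
move=> _ [s /= <- <-]; elim/last_ind: s => [|s y [u au [v bv /= eq_uv]]].
  have val0 c : commg_value_classes 0 c c.
    by exists c; [exists [::]|exists 1 => //; rewrite conjg1].
  by exists a => //; exists b.
rewrite size_rcons foldl_rcons -eq_uv.
exists ([~ u, y] ^ v^-1).
  exact/commg_value_classes_conj/commg_value_classes_rcons.
exists ([~ v, y] ^ v^-1).
  exact/commg_value_classes_conj/commg_value_classes_rcons.
by rewrite /commg /conjg !gnorm.
Qed.

Lemma FC_subgroup (G : groupType) k : subgroup (FC G k.+1).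
Proof.
apply/subgroupP; split=> [|a b FCa FCb].
  apply/FCE; apply: sub_finite_set (finite_set1 1) => _ [s _ <-] /=.
  by elim: s => //= y s IHs; rewrite comm1g.
apply/FCE; apply: sub_finite_set (@commg_values_div _ _ a b) _.
apply: finite_image2; exact: commg_value_classes_finite.
Qed.

(** The values [[~ x, c ^+ m, x, .., x]] with [k] final entries equal to [x] are
finitely many, and modulo torsion they are the powers of
[d = [~ x, c, x, .., x]]; a coincidence among them makes [d] torsion, and then
[fc_engel] removes the final entries one at a time.  Starting from
[[~ x, c]] rather than [[~ c, x]] is forced, as finiteness is known for [x]. *)
Lemma fc_FC_commg_torsion (G : groupType) k (c x : G) :
  fc c -> FC G k.+1 x -> fc_torsion [~ c, x].
Proof.
move=> fcc /FCE finx; have nT := fc_torsion_normal G; pose e := [~ x, c].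
have fce : fc e by rewrite /e -invgR; exact (subgroupV (fc_subgroup G) (fc_commg x fcc)).
pose d := foldl commg e (nseq k x).
have fcd : fc d.
  by rewrite /d; elim: (k) (e) fce => [|j IHj] u fcu //=; apply/IHj/fc_commg.
pose val m := foldl commg x (c ^+ m :: nseq k x).
have valE m : eqmod (@fc_torsion G) (val m) (d ^+ m).
  apply: fc_iter_commg_eqmodX => //.
  rewrite /e -[[~ x, c]]invgR -[[~ x, c ^+ m]]invgR expVgn.
  exact/(eqmodV nT)/fc_commg_eqmodX.
have [|i [n [n_gt0 eq_val]]] := @finite_range_collision _ val.
  apply: sub_finite_set finx => _ [m _ <-].
  by exists (c ^+ m :: nseq k x) => //=; rewrite size_nseq.
have Td : fc_torsion d.
  apply: (fc_torsion_root fcd n_gt0).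
  have := eqmod_trans nT (eqmod_sym nT (valE i)) _.
  move/(_ (d ^+ (i + n))); rewrite eq_val => /(_ (valE _)).
  by rewrite /eqmod expgnDr mulKg.
apply: fc_engel2 => //.
have [sT cT] := nT.
have commVg y : [~ y^-1, x] = ([~ y, x] ^ y^-1)^-1.
  by rewrite /commg /conjg !gnorm.
rewrite -[[~ c, x]]invgR commVg.
by apply: (subgroupV sT); apply: cT; apply: fc_engel Td.
Qed.

(** * The lower central series of [FC G k] *)
Lemma lower_centralS (G : groupType) j (H : set G) :
  lower_central j.+2 H =
  generated [set [~ x, y] | x in lower_central j.+1 H & y in H].
Proof. by []. Qed.

(** Each commutation lowers the index of the FC-subgroup by one. *)
Lemma lower_central_sub_FC (G : groupType) k j : (j <= k)%N ->
  lower_central j.+1 (FC G k.+1) `<=` FC G (k - j).+1.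
Proof.
elim: j => [|j IHj] lt_jk; first by rewrite subn0.
rewrite lower_centralS; apply: generated_sub; first exact: FC_subgroup.
move=> _ [x Hx [y _ <-]]; apply: FC_commg.
by rewrite subnSK //; exact: IHj (ltnW lt_jk) x Hx.
Qed.

Lemma lower_central_subgroup (G : groupType) j (H : set G) :
  subgroup H -> subgroup (lower_central j H).
Proof. by case: j => [|[|j]] // _; exact: generated_subgroup. Qed.

Lemma lower_central_sub_torsion (G : groupType) k :
  lower_central k.+2 (FC G k.+1) `<=` @fc_torsion G.
Proof.
rewrite lower_centralS; apply: generated_sub; first exact: fc_torsion_subgroup.
move=> _ [x Hx [y Hy <-]]; apply: fc_FC_commg_torsion Hy.
by rewrite -FC1_fc; have := lower_central_sub_FC (leqnn k) Hx; rewrite subnn.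
Qed.

(** Dietzmann's lemma gives a finite normal subgroup [N] of [G] containing a
given finite subset of [H]; then [N `&` H] is normal in [H]. *)
Lemma locally_normal_sub_fc_torsion (G : groupType) (H : set G) :
  subgroup H -> H `<=` @fc_torsion G -> locally_normal H.
Proof.
move=> sH HT A finA AH.
have [||N [finN sN cN AN]] := dietzmann finA.
- by move=> x /AH /HT [].
- by move=> x /AH /HT [].
exists (N `&` H); split; first exact: finite_setIl.
- split=> [|x []//|x h [Nx Hx] Hh].
    apply/subgroupP; split=> [|x y [Nx Hx] [Ny Hy]].
      by split; [exact (subgroup1 sN)|exact (subgroup1 sH)].
    by split; [exact (subgroupM sN Nx (subgroupV sN Ny))
              |exact (subgroupM sH Hx (subgroupV sH Hy))].
  split; first exact: cN.
  exact (subgroupM sH (subgroupV sH Hh) (subgroupM sH Hx Hh)).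
- by move=> x Ax; split; [exact: AN|exact: AH].
Qed.

Theorem theorem1p3 (G : groupType) (k : nat) (hk : (1 <= k)%N) :
  subgroup (FC G k) /\ locally_normal (lower_central k.+1 (FC G k)).
Proof.
case: k hk => // k _; have sF := @FC_subgroup G k; split=> //.
apply: locally_normal_sub_fc_torsion; first exact: lower_central_subgroup.
exact: lower_central_sub_torsion.
Qed.
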